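(* Let $L$ be a C-lattice. If $L$ is not quasi-local, then each OA-element of $L$ is prime.
   Context: A multiplicative lattice is a set $L$ with a commutative associative multiplication and a partial order $\leq$ such that $(L,\leq)$ is a complete lattice with greatest element $1$ and least element $0$, and such that $1x=x$ and $x(\bigvee E)=\bigvee\{xe\mid e\in E\}$ for all $x\in L$ and $E\subseteq L$. An element $a\in L$ is compact if for each $F\subseteq L$ with $a\leq\bigvee F$ there is a finite $E\subseteq F$ with $a\leq\bigvee E$. A subset is multiplicatively closed if it contains $1$ and is closed under products. $L$ is a C-lattice if there is a multiplicatively closed subset $C\subseteq L$ of compact elements such that every element of $L$ is a join of elements of $C$. An element $a$ is proper if $a<1$. A proper element $m$ is maximal if $m<x\leq 1$ implies $x=1$. A proper element $p$ is prime if for all $a,b\in L$, $ab\leq p$ implies $a\leq p$ or $b\leq p$. $L$ is quasi-local if $1$ is compact and $L$ has a unique maximal element. A proper element $x$ of a C-lattice $L$ is an OA-element ($1$-absorbing prime element) if for all $a,b,c\in L\setminus\{1\}$, $abc\leq x$ implies $ab\leq x$ or $c\leq x$. *)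

(* Defs.v *)
From HB Require Import structures.
From mathcomp Require Import all_boot all_order.
From mathcomp Require Import mathcomp_extra boolp classical_sets functions.
From mathcomp Require Import cardinality.

Set Implicit Arguments.
Unset Strict Implicit.
Unset Printing Implicit Defensive.

Import Order.TTheory.

Local Open Scope classical_set_scope.
Local Open Scope order_scope.

Reserved Notation "\bigvee E" (at level 10, E at level 8, format "\bigvee  E").
Reserved Notation "a ** b" (at level 40, left associativity).

HB.mixin Record isCompleteLattice d (L : Type) of Order.TBLattice d L := {
  join_set : set L -> L;
  meet_set : set L -> L;
  join_setP : forall E : set L, supremums E (join_set E);
  meet_setP : forall E : set L, infimums E (meet_set E)
}.

#[short(type="completeLatticeType")]
HB.structure Definition CompleteLattice d :=
  {L of Order.TBLattice d L & isCompleteLattice d L}.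

Notation "\bigvee E" := (join_set E) : order_scope.

(* The unit of the multiplication is the greatest element [\top], and the
   informal 0 is [\bot]. [E] may be empty in [lmul_join_set]. *)
HB.mixin Record isMultLattice d (L : Type) of CompleteLattice d L := {
  lmul : L -> L -> L;
  lmulA : associative lmul;
  lmulC : commutative lmul;
  lmul1x : left_id (\top : L) lmul;
  lmul_join_set : forall (x : L) (E : set L),
    lmul x (\bigvee E) = \bigvee [set lmul x e | e in E]
}.

#[short(type="multLatticeType")]
HB.structure Definition MultLattice d :=
  {L of CompleteLattice d L & isMultLattice d L}.

Notation "a ** b" := (lmul a b) : order_scope.

HB.instance Definition _ d (L : multLatticeType d) :=
  Monoid.isComLaw.Build L \top (@lmul d L)
    (@lmulA d L) (@lmulC d L) (@lmul1x d L).

Section MultiplicativeLattices.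
Context {d : Order.disp_t} {L : multLatticeType d}.
Implicit Types (a b c m p x : L) (C E F : set L).

Definition compact_element a : Prop :=
  forall F, a <= \bigvee F ->
    exists E, [/\ finite_set E, E `<=` F & a <= \bigvee E].

Definition multiplicatively_closed C : Prop :=
  C \top /\ forall a b, C a -> C b -> C (a ** b).

Definition proper_element a : Prop := a < \top.

Definition maximal_element m : Prop :=
  proper_element m /\ forall x, m < x -> x <= \top -> x = \top.

Definition prime_element p : Prop :=
  proper_element p /\ forall a b, a ** b <= p -> a <= p \/ b <= p.

(* 1-absorbing prime elements *)
Definition OA_element x : Prop :=
  proper_element x /\
  forall a b c, a <> \top -> b <> \top -> c <> \top ->
    a ** b ** c <= x -> a ** b <= x \/ c <= x.

End MultiplicativeLattices.

Definition C_lattice d (L : multLatticeType d) : Prop :=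
  exists C : set L,
    [/\ multiplicatively_closed C,
        forall c, C c -> compact_element c
      & forall x : L, exists2 E : set L, E `<=` C & x = \bigvee E].

Definition quasi_local d (L : multLatticeType d) : Prop :=
  compact_element (\top : L) /\ exists! m : L, maximal_element m.

(* Main.v *)
Require Import Defs.
From mathcomp Require Import all_boot all_order.
From mathcomp Require Import boolp classical_sets.

(** Suppose [x] is an OA-element, [a ** b <= x], and neither [a <= x] nor
    [b <= x].  The OA property forces [c ** a <= x] for every proper [c], so
    [J ** a <= x] where [J] is the join of all proper elements.  Hence
    [J <> \top], since otherwise [a <= x]; but then [J] is the greatest proper
    element, thus the only maximal one, and [L] is quasi-local. *)

Import Order.TTheory.

Local Open Scope classical_set_scope.
Local Open Scope order_scope.

Section ProperJoin.
Context {d : Order.disp_t} {L : multLatticeType d}.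
Implicit Types (x y : L) (E : set L).

Lemma join_set_ub E x : E x -> x <= \bigvee E.
Proof. by move=> Ex; case: (join_setP E) => ub _; exact: ub. Qed.

Lemma join_set_le E y : (forall x, E x -> x <= y) -> \bigvee E <= y.
Proof. by move=> leEy; case: (join_setP E) => _; apply. Qed.

(** Follows from distributivity: [\top] is the join of [x] and [\top], so [y] is the join of
    [y ** x] and [y]. *)
Lemma lmul_ler x y : x ** y <= y.
Proof.
rewrite -[leRHS]lmul1x lmulC [leRHS]lmulC.
have <- : \bigvee [set x; \top] = \top :> L.
  by apply/le_anti; rewrite lex1 join_set_ub //; right.
by rewrite lmul_join_set; apply: join_set_ub; exists x => //; left.
Qed.

(** Leaves the maximal elements as the only way for a C-lattice to fail to be quasi-local. *)
Lemma C_lattice_compact_top : C_lattice L -> compact_element (\top : L).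
Proof. by case=> C [[C1 _] Ccompact _]; exact: Ccompact. Qed.

Lemma proper_join_maximal :
  \bigvee [set c : L | proper_element c] <> \top ->
  exists! m : L, maximal_element m.
Proof.
set J := \bigvee _ => /eqP J_neq1.
have J_proper : proper_element J by rewrite /proper_element lt_neqAle J_neq1 lex1.
have le_J c : proper_element c -> c <= J by exact: join_set_ub.
exists J; split.
  split=> // y ltJy _; apply/eqP; apply: contraLR ltJy => y_neq1.
  by rewrite le_gtF // le_J // /proper_element lt_neqAle y_neq1 lex1.
(* A maximal [m] lies below [J]; were it different, its maximality would force [J = \top]. *)
move=> m [m_proper m_max]; apply/eqP; rewrite eq_sym; apply: contraT => m_neqJ.
by rewrite (m_max J _ (lex1 _)) ?eqxx // lt_neqAle m_neqJ le_J in J_neq1.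
Qed.

End ProperJoin.

Theorem proposition2p6 (d : Order.disp_t) (L : multLatticeType d) :
  C_lattice L -> ~ quasi_local L ->
  forall x : L, OA_element x -> prime_element x.
Proof.
move=> CL nqL x [x_proper x_OA]; split=> // a b le_ab.
(* The OA property concerns factors other than [\top] only, so [\top] is treated apart. *)
have [a_eq1|/eqP a_neq1] := eqVneq a \top.
  by right; rewrite a_eq1 lmul1x in le_ab.
have [b_eq1|/eqP b_neq1] := eqVneq b \top.
  by left; rewrite b_eq1 lmulC lmul1x in le_ab.
have [|b_nle] := boolP (b <= x); first by right.
left.
have [J_eq1|J_neq1] := pselect (\bigvee [set c : L | proper_element c] = \top).
  (* Now [a] is the join of all [a ** c] with [c] proper, so it suffices to bound each of these. *)
  rewrite -[a]lmul1x -J_eq1 lmulC lmul_join_set; apply: join_set_le.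
  move=> _ [c c_proper <-]; rewrite lmulC.
  have c_neq1 : c <> \top by apply/eqP; rewrite lt_eqF.
  have le_cab : c ** a ** b <= x by rewrite -lmulA (le_trans (lmul_ler _ _)).
  by case: (x_OA _ _ _ c_neq1 a_neq1 b_neq1 le_cab) => // b_le; rewrite b_le in b_nle.
by case: nqL; split; [exact: C_lattice_compact_top|exact: proper_join_maximal].
Qed.
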